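(* The complete graph $K_5$ on five vertices is not planar.
   Context: A graph, viewed as a $1$-dimensional simplicial complex, is planar if it can be embedded in the $2$-sphere (as a subcomplex of the $2$-sphere, i.e. it is isomorphic to a subcomplex of some triangulation of $\mathbb{S}^2$). *)

(* Defs.v *)
From HB Require Import structures.
From mathcomp Require Import all_boot all_order all_algebra.
From mathcomp Require Import all_classical all_reals all_analysis.

Set Implicit Arguments.
Unset Strict Implicit.
Unset Printing Implicit Defensive.

Import Order.TTheory GRing.Theory Num.Theory.
Import numFieldNormedType.Exports.

Local Open Scope ring_scope.

Record graph := Graph {
  vertex :> finType;
  adj : rel vertex;
  adj_sym : symmetric adj;
  adj_irr : irreflexive adj }.

Lemma neq_sym (T : eqType) : symmetric (fun x y : T => x != y).
Proof. by move=> x y; rewrite eq_sym. Qed.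

Lemma neq_irr (T : eqType) : irreflexive (fun x y : T => x != y).
Proof. by move=> x; rewrite eqxx. Qed.

Definition complete_graph (n : nat) : graph :=
  Graph (@neq_sym 'I_n) (@neq_irr 'I_n).

(* The empty face belongs to every complex. An element of V need not be a
   vertex of K: its vertices are the v with [set v] \in K. *)
Definition simplicial_complex (V : finType) (K : {set {set V}}) : Prop :=
  finset.set0 \in K /\
  forall s t : {set V}, s \in K -> t \subset s -> t \in K.

Definition vertices (V : finType) (K : {set {set V}}) : {set V} :=
  [set v | [set v]%SET \in K]%SET.

Definition subcomplex (V : finType) (L K : {set {set V}}) : Prop :=
  simplicial_complex L /\ L \subset K.

Definition isomorphic_complexes (V W : finType)
    (K : {set {set V}}) (L : {set {set W}}) : Prop :=
  exists f : V -> W,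
    {in vertices K &, injective f} /\ [set f @: s | s : {set V} in K]%SET = L.

Definition graph_complex (G : graph) : {set {set G}} :=
  [set s : {set G} | (#|s| <= 1)%N
     || [exists x, exists y, adj x y && (s == [set x; y])]]%SET.

Lemma graph_complex_simplicial (G : graph) :
  simplicial_complex (graph_complex G).
Proof.
split=> [|s t]; first by rewrite inE cards0.
rewrite !inE => /orP[s1 ts|/existsP[x /existsP[y /andP[xy /eqP ->]]] ts].
  by rewrite (leq_trans (subset_leq_card ts)).
have [t2|t2] := leqP #|t| 1; first by [].
apply/existsP; exists x; apply/existsP; exists y.
by rewrite xy /= eqEcard ts cards2 (leq_trans _ t2) // ltnS leq_b1.
Qed.

Local Open Scope classical_set_scope.

(* Barycentric coordinates in R^V. As V is finite, the topology of pointwise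
   convergence is the Euclidean one. *)
Definition realization (R : realType) (V : finType) (K : {set {set V}}) :
    set {ptws V -> R} :=
  [set x | [/\ forall v, 0 <= x v,
               \sum_v x v = 1 &
               [set v | x v != 0]%SET \in K]].
Arguments realization R {V} K.

Definition unit_sphere2 (R : realType) : set 'rV[R]_3 :=
  [set x : 'rV[R]_3 | \sum_i x ord0 i ^+ 2 = 1].
Arguments unit_sphere2 R : clear implicits.

Definition homeomorphic (T U : topologicalType) (A : set T) (B : set U) :
    Prop :=
  exists (f : T -> U) (g : U -> T),
    [/\ {within A, continuous f} /\ {within B, continuous g},
        set_fun A B f, set_fun B A g,
        {in A, cancel f g} & {in B, cancel g f}].

(* Since the sphere is compact, its triangulations are finite. *)
Definition triangulates_sphere2 (R : realType) (V : finType)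
    (K : {set {set V}}) : Prop :=
  simplicial_complex K /\ homeomorphic (realization R K) (unit_sphere2 R).

Definition planar (R : realType) (G : graph) : Prop :=
  exists (V : finType) (K L : {set {set V}}),
    [/\ triangulates_sphere2 R K, subcomplex L K &
        isomorphic_complexes (graph_complex G) L].

(* Main.v *)
Require Import Defs.
From mathcomp Require Import all_boot all_order all_algebra.
From mathcomp Require Import all_classical all_reals all_analysis.
From mathcomp Require Import ring lra zify.

(** Composing the homeomorphism with the edges of K5 gives paths on the sphere
    such that paths of disjoint edges do not meet. By compactness they keep a
    positive distance, so they may be replaced by spherical polygons with
    vertices in general position, still without crossings between disjoint
    edges. But (van Kampen) the number of crossings between disjoint edges is
    odd for any such drawing of K5. Indeed closed polygons cross evenly, and
    the edges disjoint from a given edge form a triangle, so straightening an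
    edge does not change the parity; for geodesic edges the parity depends
    only on the signs of the determinants of triples among five vectors, and
    the Grassmann-Pluecker relations force it to be odd. *)

Set Implicit Arguments.
Unset Strict Implicit.
Unset Printing Implicit Defensive.
Import Order.TTheory GRing.Theory Num.Theory.
Import numFieldNormedType.Exports.

(** * Crossings in chirotopes of rank three *)

Ltac distinct :=
  repeat match goal with H : is_true (uniq _) |- _ =>
    move: H; rewrite /= !inE !negb_or; intro H end;
  repeat match goal with H : is_true (_ && _) |- _ =>
    case/andP: H => ? ? end;
  rewrite /= ?inE ?negb_or;
  repeat match goal with |- is_true (_ && _) => apply/andP; split end;
  first [done | assumption | rewrite eq_sym; assumption].

Section Chirotope.
Context (T : eqType) (chi : T -> T -> T -> bool).

(* The bits u, v, w tell whether U, V, W are negative, where U - V + W = 0. *)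
Definition three_term (u v w : bool) : bool := ~~ ((u == ~~ v) && (~~ v == w)).

(* The relation [x a b][x c d] - [x a c][x b d] + [x a d][x b c] = 0: a product is
   negative when exactly one of its factors is positive. *)
Definition plucker_signs (x a b c d : T) : bool :=
  three_term (chi x a b (+) chi x c d) (chi x a c (+) chi x b d)
             (chi x a d (+) chi x b c).

Definition chirotope : Prop :=
  [/\ forall a b c, uniq [:: a; b; c] -> chi b a c = ~~ chi a b c,
      forall a b c, uniq [:: a; b; c] -> chi a c b = ~~ chi a b c &
      forall x a b c d, uniq [:: x; a; b; c; d] -> plucker_signs x a b c d].

(* Signs for which the relation
   [b c d] a - [a c d] b + [a b d] c - [a b c] d = 0
   exhibits a common ray of the open cones on a, b and on c, d. *)
Definition cross (a b c d : T) : bool :=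
  [&& chi b c d != chi a c d, chi a b d != chi a b c & chi b c d == chi a b c].

(** Signs for which Cramer's rule puts [p] in the open cone on [a], [b], [c]. *)
Definition in_triangle (a b c p : T) : bool :=
  [&& chi p b c == chi a b c, chi p a c != chi a b c & chi p a b == chi a b c].

Hypothesis chiP : chirotope.

Lemma chi_swap12 a b c : uniq [:: a; b; c] -> chi b a c = ~~ chi a b c.
Proof. by case: chiP => + _ _; apply. Qed.

Lemma chi_swap23 a b c : uniq [:: a; b; c] -> chi a c b = ~~ chi a b c.
Proof. by case: chiP => _ + _; apply. Qed.

Lemma chi_rot a b c : uniq [:: a; b; c] -> chi b c a = chi a b c.
Proof.
by move=> u; rewrite chi_swap23 1?chi_swap12 ?negbK //; distinct.
Qed.

Lemma crossC a b c d : uniq [:: a; b; c; d] -> cross a b c d = cross c d a b.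
Proof.
move=> u; rewrite /cross.
rewrite -(@chi_rot d a b) -?(@chi_rot c a b) ?(@chi_rot a c d)
  ?(@chi_rot b c d); try distinct.
by case: (chi a b c); case: (chi a b d); case: (chi a c d); case: (chi b c d).
Qed.

(* The five relations on five vectors, written with increasing triples so that
   statements about five vectors can be checked by enumerating ten signs. *)
Lemma chirotope5 a b c d e : uniq [:: a; b; c; d; e] ->
  [&& three_term (chi a b c (+) chi a d e) (chi a b d (+) chi a c e)
          (chi a b e (+) chi a c d),
      three_term (~~ chi a b c (+) chi b d e) (~~ chi a b d (+) chi b c e)
          (~~ chi a b e (+) chi b c d),
      three_term (chi a b c (+) chi c d e) (chi a c d (+) chi b c e)
          (chi a c e (+) chi b c d),
      three_term (chi a b d (+) ~~ chi c d e) (chi a c d (+) ~~ chi b d e)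
          (~~ chi a d e (+) chi b c d) &
      three_term (chi a b e (+) chi c d e) (chi a c e (+) chi b d e)
          (chi a d e (+) chi b c e)].
Proof.
move=> u; have [_ _ P] := chiP.
apply/and5P; split.
- exact: P.
- have := P b a c d e ltac:(distinct); rewrite /plucker_signs.
  by rewrite (@chi_swap12 a b c) 1?(@chi_swap12 a b d) 1?(@chi_swap12 a b e);
    try distinct.
- have := P c a b d e ltac:(distinct); rewrite /plucker_signs.
  rewrite -(@chi_rot c a b) 1?(@chi_swap12 a c d) 1?(@chi_swap12 a c e)
    1?(@chi_swap12 b c d) 1?(@chi_swap12 b c e); try distinct.
  by rewrite !addbN !addNb !negbK.
- have := P d a b c e ltac:(distinct); rewrite /plucker_signs.
  by rewrite -(@chi_rot d a b) -1?(@chi_rot d a c) -1?(@chi_rot d b c)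
    1?(@chi_swap12 c d e) 1?(@chi_swap12 b d e) 1?(@chi_swap12 a d e); try distinct.
- have := P e a b c d ltac:(distinct); rewrite /plucker_signs.
  by rewrite -(@chi_rot e a b) -1?(@chi_rot e a c) -1?(@chi_rot e b c)
    -1?(@chi_rot e a d) -1?(@chi_rot e b d) -1?(@chi_rot e c d); try distinct.
Qed.

(** The Jordan theorem modulo two for a triangle: crossing a side exchanges inside and outside. It
    is checked on the sign patterns allowed by the five relations. *)
Lemma cross_triangle p q a b c : uniq [:: p; q; a; b; c] ->
  cross p q a b (+) cross p q b c (+) cross p q a c =
  in_triangle a b c p (+) in_triangle a b c q.
Proof.
move=> /chirotope5; rewrite /cross /in_triangle /three_term.
move: (chi p q a) (chi p q b) (chi p q c) (chi p a b) (chi p a c) (chi p b c)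
  (chi q a b) (chi q a c) (chi q b c) (chi a b c).
by do 10!case.
Qed.

(** Each four of the five vectors split into two pairs in three ways, so this counts all fifteen
    pairs of disjoint edges of a geodesic K5. *)
Lemma odd_cross5 a b c d e : uniq [:: a; b; c; d; e] ->
  let cross4 x y z t := cross x y z t (+) cross x z y t (+) cross x t y z in
  cross4 a b c d (+) cross4 a b c e (+) cross4 a b d e (+) cross4 a c d e
    (+) cross4 b c d e.
Proof.
move=> u /=; rewrite /cross.
rewrite -?(@chi_rot d b c) -?(@chi_rot e b c) -?(@chi_rot e b d)
  -?(@chi_rot e c d) ?(@chi_swap23 b c d) ?(@chi_swap23 b c e)
  ?(@chi_swap23 b d e) ?(@chi_swap23 c d e); try distinct.
rewrite ?(@chi_swap23 a b c) ?(@chi_swap23 a b d) ?(@chi_swap23 a c d)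
  ?(@chi_swap23 a b e) ?(@chi_swap23 a d e) ?(@chi_swap23 a c e)
  ?(@chi_swap12 b c d) ?(@chi_swap12 b c e)
  ?(@chi_swap12 b d e) ?(@chi_swap12 c d e); try distinct.
move: (chirotope5 u); rewrite /three_term.
move: (chi a b c) (chi a b d) (chi a b e) (chi a c d) (chi a c e) (chi a d e)
  (chi b c d) (chi b c e) (chi b d e) (chi c d e).
by do 10!case.
Qed.

Lemma inj_upto_neq (w : nat -> T) n i j :
  {in [pred i | i <= n] &, injective w} -> i < j <= n -> w i != w j.
Proof.
move=> winj /andP[ij jn]; apply/eqP => /winj ijE.
have := ij; rewrite ijE ?ltnn // inE //; exact: leq_trans (ltnW ij) jn.
Qed.

(* Modulo two, the winding number around p of the path w, closed up by the
   segment from its end to its start: fan out triangles from w 0. *)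
Definition fan (w : nat -> T) n p : bool :=
  \big[addb/false]_(1 <= l < n) in_triangle (w 0) (w l) (w l.+1) p.

(** Induction on the path: a new last vertex adds to the fan the triangle on [w 0] and the last
    step, and [cross_triangle] accounts for it. *)
Lemma cross_segment_path p q w n :
  (0 < n)%N -> p != q -> {in [pred i | i <= n] &, injective w} ->
  (forall l, (l <= n)%N -> (w l != p) && (w l != q)) ->
  \big[addb/false]_(l < n) cross p q (w l) (w l.+1) =
  cross p q (w 0) (w n) (+) (fan w n p (+) fan w n q).
Proof.
case: n => // n _ pq; elim: n => [|n IHn] winj wpq.
  by rewrite big_ord1 /fan !big_geq //= addbF.
rewrite big_ord_recr {}IHn /=; last 2 first.
- by move=> i j ? ?; apply: winj; rewrite inE ltnW.
- by move=> l ?; apply: wpq; rewrite ltnW.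
have w_neq i j := @inj_upto_neq w n.+2 i j winj.
have u : uniq [:: p; q; w 0; w n.+1; w n.+2].
  have /andP[w0p w0q] := wpq 0 isT.
  have /andP[w1p w1q] := wpq n.+1 (leqnSn _).
  have /andP[w2p w2q] := wpq n.+2 (leqnn _).
  by rewrite /= !inE !negb_or !(eq_sym p) !(eq_sym q) pq w0p w0q
    w1p w1q w2p w2q !w_neq // ?leqnSn ?leqnn.
rewrite /fan !(@big_nat_recr _ _ _ n.+1) //=.
move: (cross_triangle u).
move: (cross _ _ _ _) (cross _ _ _ _) (cross _ _ _ _) (in_triangle _ _ _ _)
  (in_triangle _ _ _ _) (\big[_/_]_(_ <= _ < _) _) (\big[_/_]_(_ <= _ < _) _).
by do 7!case.
Qed.

(** Two uses of [cross_segment_path]: [w] is straightened against each step of [v], then [v] against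
    the segment from [w 0] to [w n]. The fans at inner vertices of [v] cancel. *)
Lemma cross_path_path v m w n :
  (0 < m)%N -> (0 < n)%N ->
  {in [pred i | i <= m] &, injective v} -> {in [pred i | i <= n] &, injective w} ->
  (forall k l, (k <= m)%N -> (l <= n)%N -> v k != w l) ->
  \big[addb/false]_(k < m) \big[addb/false]_(l < n)
     cross (v k) (v k.+1) (w l) (w l.+1) =
  cross (v 0) (v m) (w 0) (w n) (+)
  ((fan w n (v 0) (+) fan w n (v m)) (+) (fan v m (w 0) (+) fan v m (w n))).
Proof.
move=> m0 n0 vinj winj vw.
have neq := inj_upto_neq.
have wn : w 0 != w n by rewrite (neq _ _ _ _ winj) ?n0 ?leqnn.
have vm : v 0 != v m by rewrite (neq _ _ _ _ vinj) ?m0 ?leqnn.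
transitivity (\big[addb/false]_(k < m) (cross (w 0) (w n) (v k) (v k.+1) (+)
    (fan w n (v k) (+) fan w n (v k.+1)))).
  apply: eq_bigr => k _; have [kn km] := (ltn_ord k, ltnW (ltn_ord k)).
  have vk : v k != v k.+1 by rewrite (neq _ _ _ _ vinj) // ltnSn.
  rewrite cross_segment_path //; last first.
    by move=> l ln; rewrite !(eq_sym (w l)) !vw.
  by rewrite crossC //= !inE !negb_or !vw // vk wn.
rewrite big_split /=.
rewrite cross_segment_path //; last first.
  by move=> l ?; rewrite !vw.
rewrite (@crossC (w 0)); last first.
  by rewrite /= !inE !negb_or !(eq_sym (w _) (v _)) !vw // vm wn.
have -> : \big[addb/false]_(i < m) (fan w n (v i) (+) fan w n (v i.+1)) =
    fan w n (v 0) (+) fan w n (v m).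
  elim: (m) => [|k IHk]; first by rewrite big_ord0 addbb.
  by rewrite big_ord_recr IHk /= -addbA [in X in _ (+) X]addbA addbb.
by rewrite /= -addbA; congr (_ (+) _); rewrite addbC.
Qed.

(* Pairs of disjoint edges of K5 cross oddly often in total: by
   [cross_path_path] straightening all edges changes this number by
   the sum of fan (path i j) (v k), over all edges ij and vertices k off ij,
   each taken twice. *)
Lemma K5_crossing (I : eqType) (a b c d e : I) (v : I -> T)
    (path : I -> I -> nat -> T) n :
  uniq [:: a; b; c; d; e] -> injective v -> (0 < n)%N ->
  (forall i j, path i j 0 = v i /\ path i j n = v j) ->
  (forall i j, i != j -> {in [pred k | k <= n] &, injective (path i j)}) ->
  (forall i j k l, uniq [:: i; j; k; l] -> forall s t, (s <= n)%N -> (t <= n)%N ->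
     path i j s != path k l t) ->
  exists i j k l, uniq [:: i; j; k; l] /\ exists s t : 'I_n,
    cross (path i j s) (path i j s.+1) (path k l t) (path k l t.+1).
Proof.
move=> u vinj n0 ends pinj disj; apply: contrapT => nocross.
(* Without a crossing the double sum vanishes. The parity is written as [odd] of a natural number so
   that [lia] can cancel the fans occurring twice. *)
have K i j k l : uniq [:: i; j; k; l] -> cross (v i) (v j) (v k) (v l) =
    odd (fan (path k l) n (v i) + fan (path k l) n (v j)
         + fan (path i j) n (v k) + fan (path i j) n (v l)).
  move=> ijkl.
  have [ij kl] : i != j /\ k != l by split; distinct.
  have := cross_path_path n0 n0 (pinj _ _ ij) (pinj _ _ kl) (disj _ _ _ _ ijkl).
  rewrite big1 => [|s _]; last first.
    rewrite big1 // => t _; apply/negP => st.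
    by apply: nocross; exists i, j, k, l; split=> //; exists s, t.
  rewrite !(ends _ _).1 !(ends _ _).2 !oddD !oddb.
  move: (cross _ _ _ _) (fan _ _ _) (fan _ _ _) (fan _ _ _) (fan _ _ _).
  by do 5!case.
have vu : uniq [:: v a; v b; v c; v d; v e].
  by rewrite -[[:: _; _; _; _; _]]/(map v [:: a; b; c; d; e]) map_inj_uniq.
have := odd_cross5 vu; rewrite /= !K -?oddD; try distinct.
repeat match goal with |- context [nat_of_bool ?x] => move: (nat_of_bool x) => ? end.
lia.
Qed.

End Chirotope.

(** * Vectors in general position *)

Local Open Scope ring_scope.

Section Determinant.
Context {R : realFieldType}.
Implicit Types u v w : 'rV[R]_3.

Definition det3 u v w : R :=
  u 0 0 * (v 0 1 * w 0 2 - v 0 2 * w 0 1)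
  - u 0 1 * (v 0 0 * w 0 2 - v 0 2 * w 0 0)
  + u 0 2 * (v 0 0 * w 0 1 - v 0 1 * w 0 0).

Lemma sum_ord3 (F : 'I_3 -> R) : \sum_i F i = F 0 + F 1 + F 2.
Proof.
rewrite !big_ord_recl big_ord0 addr0 addrA.
by congr (_ + _ + _); congr F; apply: val_inj.
Qed.

Lemma ord3P (P : 'I_3 -> Prop) : P 0 -> P 1 -> P 2 -> forall i, P i.
Proof.
move=> P0 P1 P2 [[|[|[|//]]] i]; [move: P0|move: P1|move: P2];
by congr P; apply: val_inj.
Qed.

Lemma det3_cramer (a b c d : 'rV[R]_3) i :
  det3 b c d * a 0 i - det3 a c d * b 0 i + det3 a b d * c 0 i
  - det3 a b c * d 0 i = 0.
Proof. by move: i; apply: ord3P; rewrite /det3; ring. Qed.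

Lemma neq0_addb_gt0 (x y : R) : x != 0 -> y != 0 ->
  (0 < x) (+) (0 < y) = (x * y < 0).
Proof.
move=> x0 y0; case: (ltgtP x 0) x0 => // xs _; case: (ltgtP y 0) y0 => // ys _ /=.
- by rewrite nmulr_rlt0 // ltNge ltW.
- by rewrite nmulr_rlt0.
- by rewrite pmulr_rlt0.
- by rewrite pmulr_rlt0 // ltNge ltW.
Qed.

Definition generic (T : eqType) (y : T -> 'rV[R]_3) : Prop :=
  forall a b c, uniq [:: a; b; c] -> det3 (y a) (y b) (y c) != 0.

Definition orientation (T : eqType) (y : T -> 'rV[R]_3) a b c : bool :=
  0 < det3 (y a) (y b) (y c).

Lemma generic_chirotope (T : eqType) (y : T -> 'rV[R]_3) :
  generic y -> chirotope (orientation y).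
Proof.
move=> gen; rewrite /orientation; split=> [a b c /gen|a b c /gen|].
- have -> : det3 (y b) (y a) (y c) = - det3 (y a) (y b) (y c).
    by rewrite /det3; ring.
  by rewrite oppr_gt0 -leNgt le_eqVlt eq_sym => /negbTE ->.
- have -> : det3 (y a) (y c) (y b) = - det3 (y a) (y b) (y c).
    by rewrite /det3; ring.
  by rewrite oppr_gt0 -leNgt le_eqVlt eq_sym => /negbTE ->.
move=> x a b c d u; rewrite /plucker_signs /three_term.
rewrite !neq0_addb_gt0; try by apply: gen; distinct.
have : det3 (y x) (y a) (y b) * det3 (y x) (y c) (y d)
  - det3 (y x) (y a) (y c) * det3 (y x) (y b) (y d)
  + det3 (y x) (y a) (y d) * det3 (y x) (y b) (y c) = 0.
  by rewrite /det3; ring.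
move: (_ * _) (_ * _) (_ * _) => p q r pqr.
apply/negP => /andP[/eqP + /eqP].
by case: (ltP p 0); case: (ltP q 0); case: (ltP r 0) => //= *; lra.
Qed.

Lemma cross_cones (T : eqType) (y : T -> 'rV[R]_3) a b c d :
  generic y -> uniq [:: a; b; c; d] -> cross (orientation y) a b c d ->
  exists s t p q : R, [/\ 0 < s, 0 < t, 0 < p & 0 < q] /\
    forall i, s * y a 0 i + t * y b 0 i = p * y c 0 i + q * y d 0 i.
Proof.
move=> gen u; rewrite /cross /orientation.
have := det3_cramer (y a) (y b) (y c) (y d).
have : det3 (y b) (y c) (y d) != 0 by apply: gen; distinct.
have : det3 (y a) (y c) (y d) != 0 by apply: gen; distinct.
have : det3 (y a) (y b) (y d) != 0 by apply: gen; distinct.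
have : det3 (y a) (y b) (y c) != 0 by apply: gen; distinct.
move: (det3 _ _ _) (det3 _ _ _) (det3 _ _ _) (det3 _ _ _) => m l k j.
(* Here [m], [l], [k], [j] are the determinants [b c d], [a c d], [a b d], [a b c]. A crossing
   leaves two opposite sign patterns; the terms in [c] and [d] go to the right. *)
case: (ltgtP j 0) => // js _; case: (ltgtP k 0) => // ks _;
case: (ltgtP l 0) => // ls _; case: (ltgtP m 0) => // ms _ rel //= _.
- exists (- m), l, k, (- j); split; first by split; lra.
  by move=> i; have := rel i; lra.
- exists m, (- l), (- k), j; split; first by split; lra.
  by move=> i; have := rel i; lra.
Qed.

(** Put [S = s + t] and [U = p + q]. For unit vectors, |S A - U C|^2 = (S - U)^2 + S U |A - C|^2,
    and each coordinate of S A - U C is at most (S + U) e in absolute value. As |A - C|^2 <= 4, four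
    times the right side bounds (S + U)^2 |A - C|^2; hence 12 = 4 * 3. *)
Lemma meeting_cones_close (e : R) (a b c d A C : 'rV[R]_3) (s t p q : R) :
  \sum_i A 0 i ^+ 2 = 1 -> \sum_i C 0 i ^+ 2 = 1 ->
  (forall i, `|a 0 i - A 0 i| <= e) -> (forall i, `|b 0 i - A 0 i| <= e) ->
  (forall i, `|c 0 i - C 0 i| <= e) -> (forall i, `|d 0 i - C 0 i| <= e) ->
  [/\ 0 < s, 0 < t, 0 < p & 0 < q] ->
  (forall i, s * a 0 i + t * b 0 i = p * c 0 i + q * d 0 i) ->
  \sum_i (A 0 i - C 0 i) ^+ 2 <= 12 * e ^+ 2.
Proof.
move=> A1 C1 aA bA cC dC [s0 t0 p0 q0] rel.
pose S := s + t; pose U := p + q.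
have coord i : (S * A 0 i - U * C 0 i) ^+ 2 <= ((S + U) * e) ^+ 2.
  rewrite -(real_normK (num_real (_ - _))) ler_sqr ?nnegrE
    ?normr_ge0 ?mulr_ge0 //; last 2 first.
  - by rewrite /S /U; lra.
  - exact: le_trans (aA i).
  have -> : S * A 0 i - U * C 0 i = p * (c 0 i - C 0 i) + q * (d 0 i - C 0 i)
      - s * (a 0 i - A 0 i) - t * (b 0 i - A 0 i).
    by have := rel i; rewrite /S /U; lra.
  move: (aA i) (bA i) (cC i) (dC i); rewrite !ler_norml /S /U.
  move: (_ - _) (_ - _) (_ - _) (_ - _) => x1 x2 x3 x4.
  move=> /andP[? ?] /andP[? ?] /andP[? ?] /andP[? ?].
  by apply/andP; split; nra.
have := (coord 0, coord 1, coord 2).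
move: A1 C1; rewrite !sum_ord3 => A1 C1 [[c0 c1] c2].
set D := (X in X <= _).
have S0 : 0 < S + U by rewrite /S /U; lra.
have D4 : D <= 4.
  have : 0 <= (A 0 0 + C 0 0) ^+ 2 + (A 0 1 + C 0 1) ^+ 2 + (A 0 2 + C 0 2) ^+ 2.
    by rewrite !addr_ge0 ?sqr_ge0.
  by rewrite /D; lra.
have key : (S - U) ^+ 2 + S * U * D <= 3 * ((S + U) * e) ^+ 2.
  have -> : (S - U) ^+ 2 + S * U * D =
    (S * A 0 0 - U * C 0 0) ^+ 2 + (S * A 0 1 - U * C 0 1) ^+ 2
    + (S * A 0 2 - U * C 0 2) ^+ 2
    + (S ^+ 2 - S * U) * (1 - (A 0 0 ^+ 2 + A 0 1 ^+ 2 + A 0 2 ^+ 2))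
    + (U ^+ 2 - S * U) * (1 - (C 0 0 ^+ 2 + C 0 1 ^+ 2 + C 0 2 ^+ 2)).
    by rewrite /D; ring.
  by rewrite A1 C1 !subrr; lra.
have : (S + U) ^+ 2 * D <= (S + U) ^+ 2 * (12 * e ^+ 2).
  have : 0 <= (S - U) ^+ 2 * (4 - D) by rewrite mulr_ge0 ?sqr_ge0 ?subr_ge0.
  by move: key; lra.
by rewrite ler_pM2l // exprn_gt0.
Qed.

Lemma generic_perturbation (T : finType) (x : T -> 'rV[R]_3) (e : R) :
  0 < e -> exists2 y : T -> 'rV[R]_3,
    generic y & forall a i, `|y a 0 i - x a 0 i| <= e.
Proof.
move=> e0.
pose node (a : T) : R := (enum_rank a)%:R.
(* Points on the moment curve are generic, so the determinants of
   [x a + t *: curve a] are nonzero cubic polynomials in t. *)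
pose curve a : 'rV[R]_3 := \row_i node a ^+ i.
pose cubic a b c : {poly R} := Poly [::
  det3 (x a) (x b) (x c);
  det3 (curve a) (x b) (x c) + det3 (x a) (curve b) (x c)
    + det3 (x a) (x b) (curve c);
  det3 (x a) (curve b) (curve c) + det3 (curve a) (x b) (curve c)
    + det3 (curve a) (curve b) (x c);
  det3 (curve a) (curve b) (curve c)].
have cubicE a b c t : (cubic a b c).[t] =
    det3 (x a + t *: curve a) (x b + t *: curve b) (x c + t *: curve c).
  by rewrite horner_Poly /= /det3 !mxE; ring.
have cubic_neq0 a b c : uniq [:: a; b; c] -> cubic a b c != 0.
  move=> u; apply: contraTneq isT => /(congr1 (fun p : {poly R} => p`_3)).
  rewrite coef_Poly coef0 /=.
  have -> : det3 (curve a) (curve b) (curve c) =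
      (node b - node a) * (node c - node a) * (node c - node b).
    by rewrite /det3 !mxE /=; ring.
  have node_inj : injective node.
    by move=> i j /eqP; rewrite eqr_nat => /eqP/val_inj/enum_rank_inj.
  move/eqP; rewrite !mulf_eq0 !subr_eq0 !(inj_eq node_inj).
  by move=> /orP[/orP[]|]/eqP E; move: u; rewrite E /= !inE eqxx ?orbT ?andbF.
pose P := \prod_(abc : T * T * T | uniq [:: abc.1.1; abc.1.2; abc.2])
  cubic abc.1.1 abc.1.2 abc.2.
have P0 : P != 0 by apply/prodf_neq0 => -[[a b] c] /= /cubic_neq0.
(* [M] bounds the coordinates 1, [node a], [node a ^+ 2] of the curve, so a positive t <= e / M
   moves no coordinate by more than [e]. *)
pose M : R := #|T|%:R ^+ 2 + 1.
have M0 : 0 < M by rewrite ltr_wpDl ?exprn_ge0 ?ler0n.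
(* These [size P] distinct values exceed the degree of [P] by one, so one of them is not a root. *)
pose ts : seq R := [seq e / M / n.+1%:R | n <- iota 0 (size P)].
have uts : uniq ts.
  rewrite map_inj_uniq ?iota_uniq // => m n.
  move/mulfI => /(_ _)/invr_inj/eqP; rewrite eqr_nat eqSS => /(_ _)/eqP; apply.
  by rewrite gt_eqF ?divr_gt0.
have : ~~ all (root P) ts.
  apply/negP => /(max_poly_roots P0) /(_ uts).
  by rewrite size_map size_iota ltnn.
case/allPn => t /mapP[n _ tE] nroot.
exists (fun a => x a + t *: curve a).
  move=> a b c u; rewrite -cubicE; apply: contra nroot => /eqP c0.
  by rewrite /root /P horner_prod (bigD1 (a, b, c)) //= c0 mul0r.
move=> a i; rewrite !mxE addrAC subrr add0r.
have node_ge0 : 0 <= node a ^+ i by rewrite exprn_ge0 ?ler0n.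
have nodeM : node a ^+ i <= M.
  have node_le : node a <= #|T|%:R by rewrite ler_nat ltnW.
  have := lerXn2r 2 (ler0n _ _) (ler0n _ _) node_le; rewrite /M.
  have := sqr_ge0 (node a - 1); have := ler0n R (enum_rank a).
  by move: i {node_ge0}; apply: ord3P;
    rewrite ?expr0 ?expr1 /= -/(node a); nra.
rewrite ger0_norm ?mulr_ge0 // tE ?divr_ge0 ?ler0n //; try exact: ltW.
rewrite mulrAC ler_pdivrMr ?ltr0n // mulrAC ler_pdivrMr // -mulrA.
rewrite ler_pM2l //; apply: le_trans nodeM _.
by rewrite ler_peMl ?(ltW M0) // ler1n.
Qed.

End Determinant.

(** * Paths on the sphere *)

Local Open Scope classical_set_scope.

(** The pointwise topology is the supremum of those induced by the evaluations; constant functions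
    make the evaluations onto. *)
Lemma ptws_cvg (U : Type) (X : topologicalType) (F : set_system (U -> X))
    (f : U -> X) : Filter F ->
  (forall u, g u @[g --> F] --> f u) -> {ptws, F --> f}.
Proof.
move=> FF Ff; apply/cvg_sup => u; apply/cvg_image.
  by rewrite eqEsubset; split=> // x _; exists (cst x).
move=> W /Ff FW /=; exists ((fun g : U -> X => g u) @^-1` W) => //.
by rewrite image_preimage // eqEsubset; split=> // x _; exists (cst x).
Qed.

(** * Consequences of the compactness of the unit interval *)

Section Mesh.
Context {R : realType}.

(** The increment tends to 0 as the point tends to [x] and [n] to infinity jointly; compactness, in
    its near-covering form, makes this uniform. *)
Lemma uniform_mesh (h : R -> R) (e : R) : continuous h -> 0 < e ->
  \forall n \near \oo, forall x, x \in `[0, 1]%R ->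
    `|h (x + n.+1%:R^-1) - h x| <= e.
Proof.
move=> ch e0.
have /compact_near_coveringP := @segment_compact R 0 1.
move=> /(_ nat \oo (fun n x => `|h (x + n.+1%:R^-1) - h x| <= e) _); apply => x _.
have : (fun z : R * nat => h (z.1 + z.2.+1%:R^-1) - h z.1) @
    (nbhs x, \oo) --> h (x + 0) - h x.
  apply: cvgB.
    apply: (@cvg_comp _ _ _ (fun z : R * nat => z.1 + z.2.+1%:R^-1) h);
      last exact: ch.
    apply: cvgD; first exact: cvg_fst.
    apply: (@cvg_comp _ _ _ snd (fun n : nat => n.+1%:R^-1)); first exact: cvg_snd.
    exact: cvg_harmonic.
  apply: (@cvg_comp _ _ _ fst h); [exact: cvg_fst|exact: ch].
move/cvgrPdist_le => /(_ e e0); rewrite addr0 subrr.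
by apply: filterS => z; rewrite sub0r normrN.
Qed.

(** The squared distance attains a minimum on the unit square, positive by disjointness. The [\near]
    form lets finitely many pairs of paths share one [d]. *)
Lemma positive_distance (m : nat) (f g : R -> 'rV[R]_m) :
  (forall i, continuous (fun t => f t 0 i)) ->
  (forall i, continuous (fun t => g t 0 i)) ->
  (forall s t, s \in `[0, 1]%R -> t \in `[0, 1]%R -> f s <> g t) ->
  \forall d \near 0^'+, forall s t, s \in `[0, 1]%R -> t \in `[0, 1]%R ->
    d <= \sum_i (f s 0 i - g t 0 i) ^+ 2.
Proof.
move=> cf cg fg.
pose D (z : R * R) := \sum_i (f z.1 0 i - g z.2 0 i) ^+ 2.
have cD : continuous D.
  move=> z; apply: cvg_big => [|i _]; first exact: add_continuous.
  apply: (@cvg_comp _ _ _ (fun z : R * R => f z.1 0 i - g z.2 0 i)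
    (fun u : R => u ^+ 2)); last exact: exprn_continuous.
  apply: cvgB.
    apply: (@cvg_comp _ _ _ fst (fun t => f t 0 i)); [exact: cvg_fst|exact: cf].
  apply: (@cvg_comp _ _ _ snd (fun t => g t 0 i)); [exact: cvg_snd|exact: cg].
have [| | |c + Dmin] := @compact_EVT_min _ R D (`[0, 1] `*` `[0, 1])%classic.
- by exists (0, 0); split; rewrite /= in_itv /= lexx ler01.
- by apply: compact_setX; exact: segment_compact.
- exact: continuous_subspaceT.
rewrite inE => -[/= c1 c2].
have D0 : 0 < D c.
  rewrite lt_neqAle sumr_ge0 ?andbT => [|i _]; last exact: sqr_ge0.
  apply/eqP => /esym/psumr_eq0P Dc; apply: (fg c.1 c.2) => //.
  apply/rowP => i; apply/eqP; rewrite -subr_eq0 -sqrf_eq0.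
  by rewrite Dc // => j _; exact: sqr_ge0.
near=> d => s t s01 t01; apply: (@le_trans _ _ (D c)).
  by near: d; exact: nbhs_right_le.
by apply: (Dmin (s, t)); rewrite inE; split.
Unshelve. all: by end_near.
Qed.

End Mesh.

Lemma spherical_K5 {R : realType} (x : 'I_5 -> 'rV[R]_3)
    (g : 'I_5 -> 'I_5 -> R -> 'rV[R]_3) :
  (forall i j k, continuous (fun t => g i j t 0 k)) ->
  (forall i j, g i j 0 = x i /\ g i j 1 = x j) ->
  (forall i j t, \sum_k g i j t 0 k ^+ 2 = 1) ->
  ~ (forall i j k l, uniq [:: i; j; k; l] ->
     forall s t, s \in `[0, 1]%R -> t \in `[0, 1]%R -> g i j s <> g k l t).
Proof.
move=> cg ends sphere disj.
have [d d0 dist] : exists2 d : R, 0 < d &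
    forall i j k l, uniq [:: i; j; k; l] ->
    forall s t, s \in `[0, 1]%R -> t \in `[0, 1]%R ->
      d <= \sum_m (g i j s 0 m - g k l t 0 m) ^+ 2.
  have : \forall d \near (0 : R)^'+, forall q : 'I_5 * 'I_5 * 'I_5 * 'I_5,
      uniq [:: q.1.1.1; q.1.1.2; q.1.2; q.2] ->
      forall s t, s \in `[0, 1]%R -> t \in `[0, 1]%R ->
      d <= \sum_m (g q.1.1.1 q.1.1.2 s 0 m - g q.1.2 q.2 t 0 m) ^+ 2.
    apply: filter_forall => -[[[i j] k] l] /=.
    have [u|nu] := boolP (uniq [:: i; j; k; l]); last first.
      by apply: nearW => d u; case/negP: nu.
    apply: filterS (positive_distance (cg i j) (cg k l) (disj _ _ _ _ u)).
    by move=> d dle _.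
  move=> near_d; near (0 : R)^'+ => d; exists d => [|i j k l].
    by near: d; exact: nbhs_right_gt.
  by move: i j k l; near: d; apply: filterS near_d => d dle i j k l;
    exact: (dle (i, j, k, l)).
(* As [e <= 1], 12 (2 e)^2 = 48 e^2 <= 48 e < 49 e <= d. *)
pose e := Num.min 1 (d / 49).
have e0 : 0 < e by rewrite lt_min ltr01 divr_gt0.
have e2 : 12 * (2 * e) ^+ 2 < d.
  have [e1 ed] : e <= 1 /\ e <= d / 49 by rewrite /e !ge_min !lexx orbT.
  by nra.
have [n mesh] : exists n : nat, forall i j m s, s \in `[0, 1]%R ->
    `|g i j (s + n.+1%:R^-1) 0 m - g i j s 0 m| <= e.
  have : \forall n \near \oo, forall q : 'I_5 * 'I_5 * 'I_3, forall s,
      s \in `[0, 1]%R ->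
      `|g q.1.1 q.1.2 (s + n.+1%:R^-1) 0 q.2 - g q.1.1 q.1.2 s 0 q.2| <= e.
    by apply: filter_forall => -[[i j] m]; exact: uniform_mesh.
  move=> near_n; near \oo => n; exists n => i j m.
  by move: i j m; near: n; apply: filterS near_n => n nle i j m;
    exact: (nle (i, j, m)).
(* [(i, j, k)] labels sample [k] of the path [ij]. All paths with an end at [i] share the label
   [v i], which samples [g i i] at time 0, that is [x i]. *)
pose T : finType := ('I_5 * 'I_5 * 'I_n.+1)%type.
pose v (i : 'I_5) : T := (i, i, ord0).
pose path (i j : 'I_5) (k : nat) : T :=
  if k == 0 then v i else if k == n.+1 then v j else (i, j, inord k).
pose time (k : nat) : R := k%:R / n.+1%:R.
have time01 k : (k <= n.+1)%N -> time k \in `[0, 1]%R.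
  move=> kn; rewrite in_itv /= divr_ge0 ?ler0n //=.
  by rewrite ler_pdivrMr ?ltr0n // mul1r ler_nat.
have timeS k : time k.+1 = time k + n.+1%:R^-1.
  by rewrite /time -[k.+1]addn1 natrD mulrDl mul1r.
have [y ygen yx] := generic_perturbation
  (fun q : T => g q.1.1 q.1.2 (time q.2)) e0.
have path_close i j k m : (k <= n.+1)%N ->
    `|y (path i j k) 0 m - g i j (time k) 0 m| <= e.
  move=> kn; have := yx (path i j k) m; rewrite /path.
  case: eqP => [->|_] /=.
    by rewrite /time mul0r !(ends _ _).1.
  case: eqP => [->|/eqP kn1] /=.
    by rewrite /time mul0r divff ?pnatr_eq0 // (ends _ _).1 (ends _ _).2.
  by rewrite inordK // ltn_neqAle kn1.
have uI5 : uniq [:: 0; 1; 2; 3; 4 : 'I_5] by [].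
have vinj : injective v by move=> i j [].
have path_ends i j : path i j 0 = v i /\ path i j n.+1 = v j.
  by rewrite /path /= eqxx.
have path_inj i j : i != j -> {in [pred k | (k <= n.+1)%N] &, injective (path i j)}.
  move=> /eqP ij k l; rewrite !inE => kn ln; rewrite /path.
  have lt k' : (k' <= n.+1)%N -> k' <> n.+1 -> (k' < n.+1)%N.
    by move=> ? /eqP kn'; rewrite ltn_neqAle kn'.
  case: (k =P 0%N) => [->|k0]; case: (l =P 0%N) => [->|l0] //.
  - by case: eqP => _ [] /ij.
  - by case: eqP => _ [] /esym/ij.
  - case: (k =P n.+1) => [->|k1]; case: (l =P n.+1) => [->|l1] // [].
    + by move=> /esym/ij.
    + by move=> /ij.
    + by move/(congr1 (@nat_of_ord _)); rewrite !inordK //; exact: lt.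
have path_disj i j k l : uniq [:: i; j; k; l] -> forall s t,
    (s <= n.+1)%N -> (t <= n.+1)%N -> path i j s != path k l t.
  move=> u s t _ _.
  have fst_path a b r : (path a b r).1.1 \in [:: a; b].
    by rewrite /path; case: eqP => _ /=; last case: eqP => _ /=;
      rewrite !inE eqxx ?orbT.
  apply/eqP => E; have := fst_path i j s; rewrite E.
  have := fst_path k l t; rewrite !inE => /orP[]/eqP -> /orP[]/eqP E';
  by move: u; rewrite /= E' !inE !eqxx ?orbT ?andbF.
have [i [j [k [l [u [s [t st]]]]]]] := K5_crossing (generic_chirotope ygen)
  uI5 vinj (ltn0Sn n) path_ends path_inj path_disj.
have [ij kl] : i != j /\ k != l by split; distinct.
have [sn tn] := (ltn_ord s, ltn_ord t).
have ucross : uniq [:: path i j s; path i j s.+1; path k l t; path k l t.+1].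
  rewrite /= !inE !negb_or !(path_disj _ _ _ _ u) ?(ltnW sn) ?(ltnW tn) //.
  rewrite (inj_upto_neq (path_inj _ _ ij)) ?ltnSn //.
  by rewrite (inj_upto_neq (path_inj _ _ kl)) ?ltnSn.
(* Both ends of a step are compared with the same point: one [e] pays for the perturbation, the
   other for the mesh. *)
have step a b r m : (r < n.+1)%N ->
    `|y (path a b r) 0 m - g a b (time r) 0 m| <= 2 * e /\
    `|y (path a b r.+1) 0 m - g a b (time r) 0 m| <= 2 * e.
  move=> rn; have := path_close a b r m (ltnW rn).
  have := path_close a b r.+1 m rn; have := mesh a b m (time r) (time01 _ (ltnW rn)).
  rewrite -timeS !ler_norml => /andP[? ?] /andP[? ?] /andP[? ?].
  by split; apply/andP; split; lra.
have [al [be [ga [de [pos rel]]]]] := cross_cones ygen ucross st.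
have := meeting_cones_close (sphere i j (time s)) (sphere k l (time t))
  (fun m => (step i j s m sn).1) (fun m => (step i j s m sn).2)
  (fun m => (step k l t m tn).1) (fun m => (step k l t m tn).2) pos rel.
apply/negP; rewrite -ltNge; apply: lt_le_trans e2 _.
by apply: dist => //; apply: time01; exact: ltnW.
Unshelve. all: by end_near.
Qed.

(** * Edges in barycentric coordinates *)

Section EdgePath.
Context {R : realType} {V : finType}.
Implicit Types (a b c d v : V) (s t : R).

Definition clamp t : R := Num.max 0 (Num.min 1 t).

Lemma clamp_itv t : 0 <= clamp t <= 1.
Proof. by rewrite /clamp le_max lexx ge_max ler01 ge_min lexx. Qed.

Lemma clamp_id t : t \in `[0, 1]%R -> clamp t = t.
Proof.
by rewrite in_itv /= /clamp => /andP[t0 t1]; rewrite (min_idPr t1) (max_idPr t0).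
Qed.

Lemma clamp_continuous : continuous clamp.
Proof.
move=> t; apply: continuous_max; first exact: cst_continuous.
apply: continuous_min; [exact: cst_continuous|exact: cvg_id].
Qed.

(* Constant outside [0, 1], so that it stays in the closed edge. *)
Definition edge_path a b t : {ptws V -> R} :=
  fun v => (1 - clamp t) * (v == a)%:R + clamp t * (v == b)%:R.

Lemma edge_path_continuous a b : continuous (edge_path a b).
Proof.
move=> t; apply: ptws_cvg => v.
suff : continuous (fun t : R => (1 - clamp t) * (v == a)%:R
    + clamp t * (v == b)%:R : R) by apply.
move=> {}t.
apply: cvgD; (apply: cvgM; last exact: cvg_cst); last exact: clamp_continuous.
by apply: cvgB; [exact: cvg_cst|exact: clamp_continuous].
Qed.

Lemma edge_path_realization (K : {set {set V}}) a b t :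
  simplicial_complex K -> [set a; b]%SET \in K -> realization R K (edge_path a b t).
Proof.
move=> [_ Kdown] abK; have /andP[t0 t1] := clamp_itv t; split=> [v||].
- by rewrite addr_ge0 ?mulr_ge0 ?ler0n ?subr_ge0.
- have sum1 c : \sum_v (v == c)%:R = 1 :> R.
    by rewrite (bigD1 c) //= eqxx big1 ?addr0 // => v /negbTE ->.
  by rewrite /edge_path big_split /= -!mulr_sumr !sum1; ring.
- apply: Kdown abK _; apply/fintype.subsetP => v; rewrite !inE.
  by apply: contraR; rewrite negb_or /edge_path => /andP[/negbTE -> /negbTE ->];
    rewrite !mulr0 addr0.
Qed.

Lemma edge_path_support a b t : edge_path a b t a + edge_path a b t b != 0.
Proof.
rewrite /edge_path !eqxx !mulr1; have /andP[t0 t1] := clamp_itv t.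
rewrite gt_eqF //; case: (a == b); case: (b == a) => /=; lra.
Qed.

(** On the edge [ab] the coordinates at [a] and [b] never both vanish, as they do on [cd]. *)
Lemma edge_path_disjoint a b c d s t : uniq [:: a; b; c; d] ->
  edge_path a b s <> edge_path c d t.
Proof.
move=> u E; have := edge_path_support a b s; rewrite E /edge_path.
have [ac [ad [bc bd]]] : a != c /\ a != d /\ b != c /\ b != d.
  by do !split; distinct.
by rewrite (negbTE ac) (negbTE ad) (negbTE bc) (negbTE bd) !mulr0 !addr0 eqxx.
Qed.

End EdgePath.

Theorem corollary4p7 (R : realType) : ~ planar R (complete_graph 5).
Proof.
move=> [V [K [L [[Kcpx [F [G [[Fcont _] FS _ FK _]]]] [_ LK] [f [finj fL]]]]]].
have {}finj : injective f.
  have vtx i : i \in vertices (graph_complex (complete_graph 5)).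
    by rewrite !inE cards1.
  by move=> i j; apply: finj.
(* The case [i = j] is included, since [spherical_K5] also takes the constant paths [g i i]. *)
have edgeK i j : [set f i; f j]%SET \in K.
  rewrite (fintype.subsetP LK) // -fL; apply/imsetP; exists [set i; j]%SET.
    rewrite inE; apply/orP; have [->|ij] := eqVneq i j.
      by left; rewrite finset.setUid cards1.
    by right; apply/existsP; exists i; apply/existsP; exists j; rewrite /= ij eqxx.
  by rewrite imsetU !imset_set1.
pose g i j t := F (edge_path (f i) (f j) t).
have inK i j (t : R) := edge_path_realization t Kcpx (edgeK i j).
have g_ends i j : g i j 0 = F (fun v => (v == f i)%:R) /\
    g i j 1 = F (fun v => (v == f j)%:R).
  by rewrite /g /edge_path !clamp_id ?in_itv /= ?lexx ?ler01 //; split;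
    congr F; apply/funext => v; ring.
apply: (@spherical_K5 _ _ g _ g_ends) => [i j k t|i j t|i j k l u s t _ _ E].
(* [F] is only known to be continuous within the realization, which the edge path never leaves, even
   for [t] outside [0, 1]. *)
- have to_edge : edge_path (f i) (f j) s @[s --> t] -->
      within (realization R K) (nbhs (edge_path (f i) (f j) t)).
    move=> A nearA; have := edge_path_continuous nearA.
    rewrite !near_simpl /=; apply: filterS => s; apply; exact: inK.
  have /subspace_continuousP/(_ _ (inK i j t)) Fedge := Fcont.
  have gt : g i j s @[s --> t] --> g i j t by exact: cvg_comp to_edge Fedge.
  exact: cvg_comp gt (@coord_continuous _ _ _ 0 k _).
- exact: FS (inK i j t).
- have : edge_path (f i) (f j) s = edge_path (f k) (f l) t.
    exact: (can_in_inj FK) (mem_set (inK i j s)) (mem_set (inK k l t)) E.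
  apply: edge_path_disjoint.
  by rewrite -[[:: _; _; _; _]]/(map f [:: i; j; k; l]) map_inj_uniq.
Qed.
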